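(* $$\frac{64}{64\zeta(5)+176\zeta(3)-273}=\mathrm{CF}\left[n^5+(n+1)^5+16\{n^3+(n+1)^3\}-4(2n+1),\,-n^{10}\right].$$
   Context: For sequences $(a_n)_{n\ge0}$, $(b_n)_{n\ge1}$, $\mathrm{CF}[a_n,b_n]$ denotes the continued fraction $a_0+\cfrac{b_1}{a_1+\cfrac{b_2}{a_2+\ddots}}$, whose value is $\lim_{n\to\infty}A_n/B_n$, where $A_0=1$, $A_1=a_0$, $B_0=0$, $B_1=1$, and $A_{n+1}=a_nA_n+b_nA_{n-1}$, $B_{n+1}=a_nB_n+b_nB_{n-1}$ for $n\ge1$. $\zeta$ is the Riemann zeta function. *)

(* Defs.v *)
From Stdlib Require Import Reals.
From Coquelicot Require Import Coquelicot.
Open Scope R_scope.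

Fixpoint CF_num (a b : nat -> R) (n : nat) : R :=
  match n with
  | O => 1
  | S m => match m with
           | O => a O
           | S k => a m * CF_num a b m + b m * CF_num a b k
           end
  end.

Fixpoint CF_den (a b : nat -> R) (n : nat) : R :=
  match n with
  | O => 0
  | S m => match m with
           | O => 1
           | S k => a m * CF_den a b m + b m * CF_den a b k
           end
  end.

(* The nonvanishing clause makes the quotients genuine for all large n
   (division is total in R, and CF_den a b 0 = 0).
   The value [b 0] is never used: the partial numerators start at [b 1]. *)
Definition is_CF (a b : nat -> R) (l : R) : Prop :=
  eventually (fun n => CF_den a b n <> 0) /\
  is_lim_seq (fun n => CF_num a b n / CF_den a b n) (Finite l).

(* The Dirichlet series, which is the Riemann zeta function for real s > 1 only;
   the summation index is shifted since [Series] starts at 0. *)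
Definition zeta (s : R) : R := Series (fun n => 1 / Rpower (INR (S n)) s).

(* Main.v *)
Require Import Defs.
From Stdlib Require Import Reals Factorial Lra Lia.
From Coquelicot Require Import Coquelicot.
Open Scope R_scope.

(** With [y n = (n!)^5 u n] the recurrence of the convergents becomes
    [(n+1)^5 u (n+1) = a n * u n - n^5 u (n-1)], which has the polynomial solution
    [p n = 1 + 7/2 x + 5/4 x^2], [x = n(n+1)]; it gives the numerators.  The Casoratian
    of numerators and denominators is [(n!)^10], so the reciprocal of the [n]-th convergent
    is the sum of [1 / (k^5 p(k-1) p(k))] over [1 <= k <= n].  By partial fractions this term
    is [1/k^5 + (11/4)/k^3] plus the increment of [q/p], where
    [q = 273/64 + 55/32 x], so the sum is [zeta 5 + 11/4 zeta 3 - 273/64]. *)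

Definition pden (x : R) : R :=
  1 + 7 / 2 * (x * (x + 1)) + 5 / 4 * (x * (x + 1)) ^ 2.

Definition qp (x : R) : R := (273 / 64 + 55 / 32 * (x * (x + 1))) / pden x.

Lemma pden_ge_1 (x : R) : 0 <= x -> 1 <= pden x.
Proof.
  intros Hx. unfold pden.
  assert (H : 0 <= x * (x + 1)) by nra.
  nra.
Qed.

Lemma CF_num_SS (a b : nat -> R) (n : nat) :
  CF_num a b (S (S n)) = a (S n) * CF_num a b (S n) + b (S n) * CF_num a b n.
Proof. reflexivity. Qed.

Lemma CF_den_SS (a b : nat -> R) (n : nat) :
  CF_den a b (S (S n)) = a (S n) * CF_den a b (S n) + b (S n) * CF_den a b n.
Proof. reflexivity. Qed.

Definition cf_a (n : nat) : R :=
  INR n ^ 5 + (INR n + 1) ^ 5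
  + 16 * (INR n ^ 3 + (INR n + 1) ^ 3)
  - 4 * (2 * INR n + 1).

Definition cf_b (n : nat) : R := - INR n ^ 10.

Lemma fact_S_R (n : nat) : INR (fact (S n)) = (INR n + 1) * INR (fact n).
Proof. rewrite fact_simpl, mult_INR, S_INR. reflexivity. Qed.

Lemma cf_num_closed (n : nat) :
  CF_num cf_a cf_b n = INR (fact n) ^ 5 * pden (INR n).
Proof.
  enough (H : CF_num cf_a cf_b n = INR (fact n) ^ 5 * pden (INR n)
              /\ CF_num cf_a cf_b (S n) = INR (fact (S n)) ^ 5 * pden (INR (S n)))
    by apply H.
  induction n as [|n [IH0 IH1]].
  - split; unfold pden; simpl; unfold cf_a; simpl; lra.
  - split; [exact IH1|].
    rewrite CF_num_SS, IH0, IH1, !fact_S_R. unfold cf_a, cf_b, pden.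
    rewrite !S_INR. field.
Qed.

(** In one step of the recurrence the [cf_a] terms cancel, so the Casoratian is multiplied by
    [- cf_b (S n)], which is [(n+1)^10]. *)
Lemma cf_casoratian (n : nat) :
  CF_den cf_a cf_b (S n) * CF_num cf_a cf_b n
  - CF_den cf_a cf_b n * CF_num cf_a cf_b (S n) = INR (fact n) ^ 10.
Proof.
  induction n as [|n IH].
  - simpl. ring.
  - rewrite CF_num_SS, CF_den_SS, fact_S_R, Rpow_mult_distr, <- IH.
    unfold cf_b. rewrite S_INR. ring.
Qed.

Definition cf_term (n : nat) : R :=
  1 / ((INR n + 1) ^ 5 * pden (INR n) * pden (INR n + 1)).

Lemma cf_term_pos (n : nat) : 0 < cf_term n.
Proof.
  unfold cf_term. pose proof (pos_INR n) as Hn.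
  pose proof (pden_ge_1 (INR n) Hn). pose proof (pden_ge_1 (INR n + 1) ltac:(lra)).
  apply Rdiv_lt_0_compat; [lra|].
  repeat apply Rmult_lt_0_compat; try lra.
Qed.

Lemma cf_num_pos (n : nat) : 0 < CF_num cf_a cf_b n.
Proof.
  rewrite cf_num_closed. pose proof (pden_ge_1 (INR n) (pos_INR n)).
  apply Rmult_lt_0_compat; [apply pow_lt, INR_fact_lt_0 | lra].
Qed.

(** The increment is the Casoratian over the product of the two numerators; the factorials cancel
    down to [(n+1)^5]. *)
Lemma cf_ratio_step (n : nat) :
  CF_den cf_a cf_b (S n) / CF_num cf_a cf_b (S n)
  = CF_den cf_a cf_b n / CF_num cf_a cf_b n + cf_term n.
Proof.
  assert (H : cf_term n
              = INR (fact n) ^ 10 / (CF_num cf_a cf_b n * CF_num cf_a cf_b (S n))).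
  { rewrite !cf_num_closed, fact_S_R, S_INR. unfold cf_term.
    pose proof (pos_INR n) as Hn.
    pose proof (pden_ge_1 (INR n) Hn). pose proof (pden_ge_1 (INR n + 1) ltac:(lra)).
    pose proof (INR_fact_lt_0 n).
    field. repeat split; lra. }
  rewrite H, <- cf_casoratian.
  pose proof (cf_num_pos n). pose proof (cf_num_pos (S n)).
  field. split; lra.
Qed.

Lemma cf_ratio_sum (n : nat) :
  CF_den cf_a cf_b (S n) / CF_num cf_a cf_b (S n) = sum_n cf_term n.
Proof.
  induction n as [|n IH].
  (* The sum starts from the ratio at index 0, which is [0 / 1]. *)
  - rewrite cf_ratio_step, sum_O. simpl. field.
  - rewrite cf_ratio_step, IH, sum_Sn. reflexivity.
Qed.

(** With [k = n+1], the product [pden (k-1) * pden k] is even in [k] and begins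
    [1 - 11/4 k^2 + 121/16 k^4]. As [(11/4)^2 = 121/16], its reciprocal is [1 + 11/4 k^2] up to
    order [k^6], so the pole at 0 has no [1/k] part. *)
Lemma cf_term_decomp (n : nat) :
  cf_term n = 1 / (INR n + 1) ^ 5 + 11 / 4 * (1 / (INR n + 1) ^ 3)
              + (qp (INR (S n)) - qp (INR n)).
Proof.
  unfold cf_term, qp. rewrite S_INR. pose proof (pos_INR n) as Hn.
  pose proof (pden_ge_1 (INR n) Hn) as H0.
  pose proof (pden_ge_1 (INR n + 1) ltac:(lra)) as H1.
  unfold pden in *. field. repeat split; lra.
Qed.

Lemma is_series_telescope (u : nat -> R) (l : R) :
  is_lim_seq u l -> is_series (fun n => u (S n) - u n) (l - u O).
Proof.
  intros H.
  assert (Hs : is_lim_seq (sum_n (fun n => u (S n) - u n)) (l - u O)).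
  { apply is_lim_seq_ext with (fun n => u (S n) - u O).
    - intros n. induction n as [|n IH].
      + rewrite sum_O. reflexivity.
      + rewrite sum_Sn, <- IH. unfold plus; simpl. ring.
    - apply is_lim_seq_minus'.
      + apply (is_lim_seq_incr_1 u), H.
      + apply is_lim_seq_const. }
  exact Hs.
Qed.

Lemma is_lim_seq_inv_S : is_lim_seq (fun n => / (INR n + 1)) 0.
Proof.
  apply is_lim_seq_ext with (fun n => / INR (S n)).
  - intros n. now rewrite S_INR.
  - apply (is_lim_seq_incr_1 (fun n => / INR n)).
    apply (is_lim_seq_inv INR p_infty); [apply is_lim_seq_INR | discriminate].
Qed.

(** Once the first term is dropped, the terms are at most [1/(n+2)^2], hence at most
    [1/((n+1)(n+2))], which telescopes. *)
Lemma ex_series_inv_pow (m : nat) :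
  (2 <= m)%nat -> ex_series (fun n => 1 / (INR n + 1) ^ m).
Proof.
  intros Hm. apply ex_series_incr_1.
  apply (@ex_series_le R_AbsRing R_CompleteNormedModule)
    with (b := fun n => - / (INR (S n) + 1) - - / (INR n + 1)).
  - intros n.
    change (Rabs (1 / (INR (S n) + 1) ^ m) <= - / (INR (S n) + 1) - - / (INR n + 1)).
    rewrite S_INR. pose proof (pos_INR n) as Hn.
    rewrite Rabs_right
      by (apply Rle_ge, Rlt_le, Rdiv_lt_0_compat; [lra | apply pow_lt; lra]).
    apply Rle_trans with (1 / (INR n + 1 + 1) ^ 2).
    + apply Rmult_le_compat_l; [lra|].
      apply Rinv_le_contravar; [apply pow_lt; lra | apply Rle_pow; [lra | exact Hm]].
    + replace (- / (INR n + 1 + 1) - - / (INR n + 1))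
        with (1 / ((INR n + 1) * (INR n + 1 + 1))) by (field; lra).
      apply Rmult_le_compat_l; [lra|].
      apply Rinv_le_contravar; nra.
  - exists (- 0 - - / (INR 0 + 1)).
    apply (is_series_telescope (fun n => - / (INR n + 1))).
    apply (is_lim_seq_opp _ 0), is_lim_seq_inv_S.
Qed.

Lemma is_series_zeta (m : nat) :
  (2 <= m)%nat -> is_series (fun n => 1 / (INR n + 1) ^ m) (zeta (INR m)).
Proof.
  intros Hm. unfold zeta.
  rewrite (Series_ext _ (fun n => 1 / (INR n + 1) ^ m)).
  - apply Series_correct, ex_series_inv_pow, Hm.
  - intros n. rewrite Rpower_pow by apply lt_0_INR, Nat.lt_0_succ.
    now rewrite S_INR.
Qed.

Lemma qp_lim : is_lim_seq (fun n => qp (INR n)) 0.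
Proof.
  (* The factor 5 is an integer above [qp 0 = 273/64]; with denominators cleared, the upper bound
     then holds coefficient by coefficient. *)
  apply is_lim_seq_le_le with (fun _ => 0) (fun n => 5 * / (INR n + 1)).
  - intros n. unfold qp. pose proof (pos_INR n) as Hn.
    pose proof (pden_ge_1 (INR n) Hn) as Hp. split.
    + apply Rlt_le, Rdiv_lt_0_compat; nra.
    + apply (Rmult_le_reg_r (pden (INR n) * (INR n + 1))); [nra|].
      field_simplify; [|lra|lra]. unfold pden.
      assert (0 <= INR n ^ 2) by (apply pow_le; lra).
      assert (0 <= INR n ^ 3) by (apply pow_le; lra).
      assert (0 <= INR n ^ 4) by (apply pow_le; lra).
      nra.
  - apply is_lim_seq_const.
  - replace 0 with (5 * 0) by ring.
    apply (is_lim_seq_scal_l _ 5 0), is_lim_seq_inv_S.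
Qed.

Lemma is_series_cf_term :
  is_series cf_term (zeta 5 + 11 / 4 * zeta 3 - 273 / 64).
Proof.
  pose proof (is_series_zeta 5 ltac:(lia)) as H5.
  pose proof (is_series_zeta 3 ltac:(lia)) as H3.
  replace (INR 5) with 5 in H5 by (simpl; ring).
  replace (INR 3) with 3 in H3 by (simpl; ring).
  pose proof (is_series_telescope _ _ qp_lim) as Hq.
  (* The constant [273/64] is the boundary term [qp 0] of the telescoping part. *)
  replace (zeta 5 + 11 / 4 * zeta 3 - 273 / 64)
    with (zeta 5 + 11 / 4 * zeta 3 + (0 - qp (INR 0)))
    by (unfold qp, pden; simpl; field).
  eapply is_series_ext; [intros n; symmetry; apply cf_term_decomp|].
  exact (is_series_plus _ _ _ _
           (is_series_plus _ _ _ _ H5 (is_series_scal_l (11 / 4) _ _ H3)) Hq).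
Qed.

(** A positive bound independent of [n] keeps the partial sums and also their limit away from 0, so
    both can be inverted. *)
Lemma sum_cf_term_lower (n : nat) : cf_term 0 <= sum_n cf_term n.
Proof.
  induction n as [|n IH].
  - rewrite sum_O. apply Rle_refl.
  - rewrite sum_Sn. unfold plus; simpl. pose proof (cf_term_pos (S n)). lra.
Qed.

Theorem theorem3p6 :
  is_CF
    (fun n : nat =>
       INR n ^ 5 + (INR n + 1) ^ 5
       + 16 * (INR n ^ 3 + (INR n + 1) ^ 3)
       - 4 * (2 * INR n + 1))
    (fun n : nat => - INR n ^ 10)
    (64 / (64 * zeta 5 + 176 * zeta 3 - 273)).
Proof.
  change (is_CF cf_a cf_b (64 / (64 * zeta 5 + 176 * zeta 3 - 273))).
  pose proof (cf_term_pos 0) as Ht.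
  assert (Hlim : is_lim_seq (sum_n cf_term) (zeta 5 + 11 / 4 * zeta 3 - 273 / 64))
    by exact is_series_cf_term.
  assert (Hpos : cf_term 0 <= zeta 5 + 11 / 4 * zeta 3 - 273 / 64)
    by exact (is_lim_seq_le _ _ (Finite (cf_term 0)) _
                sum_cf_term_lower (is_lim_seq_const _) Hlim).
  assert (Hden : forall n, CF_den cf_a cf_b (S n)
                           = CF_num cf_a cf_b (S n) * sum_n cf_term n).
  { intros n. rewrite <- cf_ratio_sum. pose proof (cf_num_pos (S n)). field. lra. }
  split.
  - exists 1%nat. intros [|n] Hn; [lia|]. rewrite Hden.
    pose proof (cf_num_pos (S n)). pose proof (sum_cf_term_lower n). nra.
  (* The shift skips index 0, where the denominator vanishes; from index 1 on, the convergent is the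
     inverse of a partial sum. *)
  - apply is_lim_seq_incr_1.
    apply is_lim_seq_ext with (fun n => / sum_n cf_term n).
    + intros n. rewrite Hden.
      pose proof (cf_num_pos (S n)). pose proof (sum_cf_term_lower n).
      field. split; lra.
    + replace (64 / (64 * zeta 5 + 176 * zeta 3 - 273))
        with (/ (zeta 5 + 11 / 4 * zeta 3 - 273 / 64)) by (field; split; lra).
      apply (is_lim_seq_inv _ _ Hlim). intros E. injection E. lra.
Qed.
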